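(* The family of all homothets of a (closed) square in the plane is self-coverable with self-coverability function $f(k)=2k+2$, and this is sharp: for every integer $k\ge 1$ and every self-coverability function $g$ of this family, $g(k)\ge 2k+2$.
   Context: A homothet of a planar set $C$ is a set of the form $\lambda C+v$ with $\lambda>0$ and $v\in\mathbb R^2$. A collection of closed sets $\mathcal S$ is self-coverable if there exists a function $f$ from the non-negative integers to the non-negative integers (a self-coverability function of $\mathcal S$) such that for any $S\in\mathcal S$ and any finite point set $P\subset S$ with $|P|=k$ there exists a subcollection $\mathcal S'\subset\mathcal S$ with $|\mathcal S'|\le f(k)$ such that $\bigcup\mathcal S'=S$ and no point of $P$ is in the interior of any $S'\in\mathcal S'$. *)

(* Defs.v *)
From mathcomp Require Import all_boot all_order all_algebra.
From mathcomp Require Import all_classical all_reals all_analysis.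
Import Order.TTheory GRing.Theory Num.Theory numFieldNormedType.Exports.

Set Implicit Arguments.
Unset Strict Implicit.
Unset Printing Implicit Defensive.

Local Open Scope classical_set_scope.
Local Open Scope card_scope.
Local Open Scope ring_scope.

Definition homothet (R : realType) (C : set 'rV[R]_2) (lambda : R)
    (v : 'rV[R]_2) : set 'rV[R]_2 :=
  [set lambda *: c + v | c in C].

Definition homothets (R : realType) (C : set 'rV[R]_2) :
    set (set 'rV[R]_2) :=
  [set S | exists (lambda : R) (v : 'rV[R]_2),
     0 < lambda /\ S = homothet C lambda v].

(* The vector u turned by a right angle: (x, y) |-> (- y, x). *)
Definition rot90 (R : realType) (u : 'rV[R]_2) : 'rV[R]_2 :=
  \row_(j < 2) (if j == 0 then - u 0 1 else u 0 0).

(* Squares in arbitrary position: p is a vertex and u, rot90 u are the two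
   edge vectors issuing from p; u != 0 excludes degenerate squares. *)
Definition is_closed_square (R : realType) (C : set 'rV[R]_2) : Prop :=
  exists p u : 'rV[R]_2, u != 0 /\
    C = [set x | exists s t : R, [/\ 0 <= s <= 1, 0 <= t <= 1 &
                   x = p + s *: u + t *: rot90 u]].

Definition self_coverability_function (T : topologicalType)
    (F : set (set T)) (f : nat -> nat) : Prop :=
  forall (S : set T) (P : set T) (k : nat),
    F S -> P `<=` S -> P #= `I_k ->
    exists F' : set (set T),
      [/\ F' `<=` F, F' #<= `I_(f k), \bigcup_(X in F') X = S &
          forall X p, F' X -> P p -> ~ interior X p].

Definition self_coverable (T : topologicalType) (F : set (set T)) : Prop :=
  (forall S, F S -> closed S) /\ exists f, self_coverability_function F f.

(* Main.v *)
Require Import Defs.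
From mathcomp Require Import all_boot all_order all_algebra.
From mathcomp Require Import all_classical all_reals all_analysis.
Import numFieldNormedType.Exports.
From mathcomp Require Import ring lra zify.
Import Order.TTheory GRing.Theory Num.Theory.

Set Implicit Arguments.
Unset Strict Implicit.
Unset Printing Implicit Defensive.

Local Open Scope classical_set_scope.
Local Open Scope ring_scope.

(* Work in coordinates where S = [0, 1]^2 and call a subsquare empty if its interior misses P.

   Upper bound.  The empty squares used are of two kinds: blocked on the left and below, or blocked
   above and on the right, a side being blocked by a point of P or by the boundary of S.  Take a
   largest empty square containing z.  It cannot be enlarged with one corner fixed, and if it is of
   neither kind it is blocked only on two opposite sides, hence can be slid parallel to them; sliding
   it as far as z permits produces a blocked square of the same size or a contradiction.  Compare
   the points by x + y.  A square blocked on the left by a and below by p is charged to the larger of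
   a and p, one blocked above and on the right to the smaller of its two blockers, and a square in
   the lower left or upper right corner of S to that corner.  The squares charged to p and lying on
   its upper left side form a chain for inclusion, and so do those on its lower right side; the union
   of a chain is dense in one empty square, so 2k + 2 squares suffice.

   Lower bound.  For P = {(w_m / 2, w_m / 2)} with w_m = 3^(m - k), 1 <= m <= k, and w_0 = 0, no empty
   square contains two of the 2k + 2 points (0, w_0), ..., (0, w_k), (w_1, 0), ..., (w_k, 0), (1, 1). *)

(** * Empty squares and blocked sides *)

(* Throughout, (l, b, h) stands for the square [l, l + h] x [b, b + h]. *)
Definition good (R : realType) (P : seq (R * R)) (l b h : R) : Prop :=
  [/\ 0 < h, 0 <= l, l + h <= 1, 0 <= b & b + h <= 1] /\
  forall p, p \in P -> ~ [/\ l < p.1, p.1 < l + h, b < p.2 & p.2 < b + h].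

Definition contains (R : realType) (z : R * R) (l b h : R) : Prop :=
  [/\ l <= z.1, z.1 <= l + h, b <= z.2 & z.2 <= b + h].

Definition inside (R : realType) (l b h l' b' h' : R) : Prop :=
  [/\ l' <= l, l + h <= l' + h', b' <= b & b + h <= b' + h'].

Ltac splits :=
  repeat match goal with
  | H : and5 _ _ _ _ _ |- _ => destruct H
  | H : and4 _ _ _ _ |- _ => destruct H
  | H : and3 _ _ _ |- _ => destruct H
  | H : _ /\ _ |- _ => destruct H
  end.

Ltac crush :=
  intros; unfold contains, inside in *; splits; simpl in *;
  repeat split; try assumption; lra.

(* Each side omits one corner, so that [blocked_left \/ blocked_top] fails exactly when the square can
   be enlarged with its lower right corner fixed. *)
Definition blocked_left (R : realType) (P : seq (R * R)) (l b h : R) : Prop :=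
  l = 0 \/ exists2 a, a \in P & [/\ a.1 = l, b < a.2 & a.2 <= b + h].

Definition blocked_bottom (R : realType) (P : seq (R * R)) (l b h : R) : Prop :=
  b = 0 \/ exists2 a, a \in P & [/\ a.2 = b, l < a.1 & a.1 <= l + h].

Definition blocked_right (R : realType) (P : seq (R * R)) (l b h : R) : Prop :=
  l + h = 1 \/ exists2 a, a \in P & [/\ a.1 = l + h, b <= a.2 & a.2 < b + h].

Definition blocked_top (R : realType) (P : seq (R * R)) (l b h : R) : Prop :=
  b + h = 1 \/ exists2 a, a \in P & [/\ a.2 = b + h, l <= a.1 & a.1 < l + h].

(** * Symmetries: half turn and transposition *)

Definition half_turn (R : realType) (P : seq (R * R)) : seq (R * R) :=
  [seq (1 - p.1, 1 - p.2) | p <- P].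

Definition transpose (R : realType) (P : seq (R * R)) : seq (R * R) :=
  [seq (p.2, p.1) | p <- P].

Lemma half_turnP (R : realType) (P : seq (R * R)) (p : R * R) :
  p \in half_turn P -> exists2 q, q \in P & p = (1 - q.1, 1 - q.2).
Proof. by move/mapP. Qed.

Lemma transposeP (R : realType) (P : seq (R * R)) (p : R * R) :
  p \in transpose P -> exists2 q, q \in P & p = (q.2, q.1).
Proof. by move/mapP. Qed.

Lemma mem_half_turn (R : realType) (P : seq (R * R)) (p : R * R) :
  p \in P -> (1 - p.1, 1 - p.2) \in half_turn P.
Proof. by move=> pP; apply/mapP; exists p. Qed.

Lemma half_turnK (R : realType) (P : seq (R * R)) : half_turn (half_turn P) = P.
Proof.
rewrite /half_turn -map_comp -[RHS]map_id; apply: eq_map => -[x y] /=.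
by rewrite !opprB !addrA; congr (_, _); lra.
Qed.

Lemma transposeK (R : realType) (P : seq (R * R)) : transpose (transpose P) = P.
Proof. by rewrite /transpose -map_comp -[RHS]map_id; apply: eq_map => -[x y]. Qed.

Lemma good_half_turn (R : realType) (P : seq (R * R)) (l b h : R) :
  good P l b h -> good (half_turn P) (1 - l - h) (1 - b - h) h.
Proof.
move=> [Q F]; split; first by crush.
by move=> _ /half_turnP[q qP ->] ?; apply: (F q qP); crush.
Qed.

Lemma good_transpose (R : realType) (P : seq (R * R)) (l b h : R) :
  good P l b h -> good (transpose P) b l h.
Proof.
move=> [Q F]; split; first by crush.
by move=> _ /transposeP[q qP ->] ?; apply: (F q qP); crush.
Qed.

Lemma blocked_left_half_turn (R : realType) (P : seq (R * R)) (l b h : R) :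
  blocked_left (half_turn P) l b h -> blocked_right P (1 - l - h) (1 - b - h) h.
Proof.
move=> [H|[_ /half_turnP[q qP ->] H]]; [by left; crush|right; exists q => //; crush].
Qed.

Lemma blocked_right_half_turn (R : realType) (P : seq (R * R)) (l b h : R) :
  blocked_right (half_turn P) l b h -> blocked_left P (1 - l - h) (1 - b - h) h.
Proof.
move=> [H|[_ /half_turnP[q qP ->] H]]; [by left; crush|right; exists q => //; crush].
Qed.

Lemma blocked_bottom_half_turn (R : realType) (P : seq (R * R)) (l b h : R) :
  blocked_bottom (half_turn P) l b h -> blocked_top P (1 - l - h) (1 - b - h) h.
Proof.
move=> [H|[_ /half_turnP[q qP ->] H]]; [by left; crush|right; exists q => //; crush].
Qed.

Lemma blocked_top_half_turn (R : realType) (P : seq (R * R)) (l b h : R) :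
  blocked_top (half_turn P) l b h -> blocked_bottom P (1 - l - h) (1 - b - h) h.
Proof.
move=> [H|[_ /half_turnP[q qP ->] H]]; [by left; crush|right; exists q => //; crush].
Qed.

Lemma blocked_left_transpose (R : realType) (P : seq (R * R)) (l b h : R) :
  blocked_left (transpose P) b l h -> blocked_bottom P l b h.
Proof.
move=> [H|[_ /transposeP[q qP ->] H]]; [by left; crush|right; exists q => //; crush].
Qed.

Lemma blocked_bottom_transpose (R : realType) (P : seq (R * R)) (l b h : R) :
  blocked_bottom (transpose P) b l h -> blocked_left P l b h.
Proof.
move=> [H|[_ /transposeP[q qP ->] H]]; [by left; crush|right; exists q => //; crush].
Qed.

Lemma blocked_right_transpose (R : realType) (P : seq (R * R)) (l b h : R) :
  blocked_right (transpose P) b l h -> blocked_top P l b h.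
Proof.
move=> [H|[_ /transposeP[q qP ->] H]]; [by left; crush|right; exists q => //; crush].
Qed.

Lemma blocked_top_transpose (R : realType) (P : seq (R * R)) (l b h : R) :
  blocked_top (transpose P) b l h -> blocked_right P l b h.
Proof.
move=> [H|[_ /transposeP[q qP ->] H]]; [by left; crush|right; exists q => //; crush].
Qed.

(** * Largest empty squares through a point *)

Lemma seq_lower_bound (R : realType) (T : eqType) (s : seq T) (f : T -> R) :
  exists2 e, 0 < e & forall x, x \in s -> 0 < f x -> e <= f x.
Proof.
elim: s => [|y s [e e0 IH]]; first by exists 1.
have [fy|fy] := ltP 0 (f y).
  exists (Num.min e (f y)); first by rewrite lt_min e0.
  by move=> x /[!inE]/orP[/eqP->|/IH H]/=; rewrite ge_min ?lexx ?orbT// => /H->.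
exists e => // x /[!inE]/orP[/eqP->|/IH//]. by move=> fy0; lra.
Qed.

(** Used to move sides of squares: pushed outward by at most [e], a side passes over no point that
    was strictly beyond its old position. *)
Lemma coordinate_gap (R : realType) (P : seq (R * R)) (a b c d : R) :
  exists2 e, 0 < e & forall p, p \in P ->
  [/\ 0 < a - p.1 -> e <= a - p.1, 0 < p.1 - b -> e <= p.1 - b,
      0 < c - p.2 -> e <= c - p.2 & 0 < p.2 - d -> e <= p.2 - d].
Proof.
have [e1 e10 H1] := seq_lower_bound P (fun p => a - p.1).
have [e2 e20 H2] := seq_lower_bound P (fun p => p.1 - b).
have [e3 e30 H3] := seq_lower_bound P (fun p => c - p.2).
have [e4 e40 H4] := seq_lower_bound P (fun p => p.2 - d).
exists (Num.min (Num.min e1 e2) (Num.min e3 e4)).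
  by rewrite !lt_min e10 e20 e30.
move=> p pP; split=> H; rewrite !ge_min.
- by rewrite (H1 p).
- by rewrite (H2 p)// orbT.
- by rewrite (H3 p)// orbT.
- by rewrite (H4 p)// !orbT.
Qed.

Definition largest (R : realType) (P : seq (R * R)) (z : R * R) (l b h : R) : Prop :=
  [/\ good P l b h, contains z l b h &
      forall l' b' h', good P l' b' h' -> contains z l' b' h' -> h' <= h].

Lemma largest_half_turn (R : realType) (P : seq (R * R)) z (l b h : R) :
  largest P z l b h ->
  largest (half_turn P) (1 - z.1, 1 - z.2) (1 - l - h) (1 - b - h) h.
Proof.
move=> [G C M]; split; [exact: good_half_turn|by crush|].
move=> l' b' h' /good_half_turn; rewrite half_turnK => /M H C'; apply: H; crush.
Qed.

Lemma largest_transpose (R : realType) (P : seq (R * R)) z (l b h : R) :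
  largest P z l b h -> largest (transpose P) (z.2, z.1) b l h.
Proof.
move=> [G C M]; split; [exact: good_transpose|by crush|].
move=> l' b' h' /good_transpose; rewrite transposeK => /M H C'; apply: H; crush.
Qed.

(** If both sides were free, a larger empty square with the same lower right corner would still
    contain [z]. *)
Lemma largest_left_top (R : realType) (P : seq (R * R)) z (l b h : R) :
  largest P z l b h -> blocked_left P l b h \/ blocked_top P l b h.
Proof.
move=> [[Q F] C M].
apply: contrapT => /not_orP[nL nT].
have l0 : 0 < l by case: Q => _ ? _ _ _; rewrite lt_neqAle; apply/andP; split=> //; apply/eqP => E; apply: nL; left.
have t1 : b + h < 1 by case: Q => _ _ _ _ ?; rewrite lt_neqAle; apply/andP; split=> //; apply/eqP => E; apply: nT; left.
have [e e0 H] := coordinate_gap P l 0 0 (b + h).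
(* Within the gap and within the distances to the two walls: growing by [d] can only take in points
   of the old left or top side. *)
set d := Num.min e (Num.min l (1 - (b + h))).
have d0 : 0 < d by rewrite !lt_min e0 l0/=; lra.
have de : d <= e by rewrite ge_min lexx.
have dl : d <= l by rewrite !ge_min lexx orbT.
have dt : d <= 1 - (b + h) by rewrite !ge_min lexx !orbT.
suff : h + d <= h by lra.
apply: (M (l - d) b); last by crush.
split; first by crush.
move=> p pP [p1 p2 p3 p4]; have [H1 _ _ H2] := H p pP.
have lp : l <= p.1 by rewrite leNgt; apply/negP => ?; have := H1; lra.
have pt : p.2 <= b + h by rewrite leNgt; apply/negP => ?; have := H2; lra.
have [E|E] := eqVneq p.1 l; first by apply: nL; right; exists p.
have [E'|E'] := eqVneq p.2 (b + h).
  by apply: nT; right; exists p => //; split=> //; lra.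
apply: (F p pP); split; [|lra|lra|].
  by rewrite lt_neqAle eq_sym E.
by rewrite lt_neqAle E'.
Qed.

Lemma largest_bottom_right (R : realType) (P : seq (R * R)) z (l b h : R) :
  largest P z l b h -> blocked_bottom P l b h \/ blocked_right P l b h.
Proof.
move=> /largest_transpose/largest_left_top[/blocked_left_transpose|/blocked_top_transpose]; by [left|right].
Qed.

(** * Sliding largest squares into blocked position *)

Lemma slide_right (R : realType) (P : seq (R * R)) (l b h m : R) :
  good P l b h -> l <= m ->
  exists l', [/\ l <= l', l' <= m, good P l' b h &
                 l' = m \/ blocked_right P l' b h].
Proof.
move=> [Q F] lm.
have [s [sl sm s1 sP sB]] : exists s, [/\ l <= s, s <= m, s + h <= 1,
   forall p, p \in P -> b < p.2 -> p.2 < b + h -> l + h <= p.1 -> s + h <= p.1 &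
   s = m \/ blocked_right P s b h].
  have {F} : {subset P <= P} by [].
  (* The induction runs over the obstacles taken into account so far, while blockers are still
     sought in all of [P]. *)
  elim: {1 3}P => [|p s IH] sub.
    have [m1|m1] := leP (m + h) 1.
      by exists m; split=> //; left.
    exists (1 - h); split=> //; try by crush.
    by right; left; lra.
  have [|s' [s1 s2 s3 s4 s5]] := IH; first by move=> q qs; apply: sub; rewrite inE qs orbT.
  have [C|C] := pselect [/\ b < p.2, p.2 < b + h, l + h <= p.1 & p.1 < s' + h].
    exists (p.1 - h); split; try by crush.
      move=> q /[!inE]/orP[/eqP->|qs]; first by lra.
      by move=> q1 q2 q3; have := s4 q qs q1 q2 q3; crush.
    right; right; exists p; first by apply: sub; rewrite inE eqxx.
    by crush.
  exists s'; split=> // q /[!inE]/orP[/eqP->|qs]; last exact: s4.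
  by move=> q1 q2 q3; rewrite leNgt; apply/negP => q4; apply: C.
exists s; split=> //; split; first by crush.
move=> p pP [p1 p2 p3 p4].
have [H|H] := leP (l + h) p.1; first by have := sP p pP p3 p4 H; lra.
by apply: (F p pP); split=> //; lra.
Qed.

(** Assumed only to be refuted. It speaks of all largest squares through [z], so it still applies
    after sliding. *)
Definition uncovered (R : realType) (P : seq (R * R)) (z : R * R) : Prop :=
  forall l b h, largest P z l b h ->
  ~ (blocked_left P l b h /\ blocked_bottom P l b h) /\
  ~ (blocked_top P l b h /\ blocked_right P l b h).

Lemma uncovered_half_turn (R : realType) (P : seq (R * R)) (z : R * R) :
  uncovered P z -> uncovered (half_turn P) (1 - z.1, 1 - z.2).
Proof.
move=> N l b h /largest_half_turn; rewrite half_turnK /= => B.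
have [|N1 N2] := N (1 - l - h) (1 - b - h) h.
  by move: B; congr (largest _ _ _ _ _); case: (z) => x y /=; congr (_, _); lra.
split=> -[].
  by move=> /blocked_left_half_turn ? /blocked_bottom_half_turn ?; apply: N2.
by move=> /blocked_top_half_turn ? /blocked_right_half_turn ?; apply: N1.
Qed.

Lemma uncovered_transpose (R : realType) (P : seq (R * R)) (z : R * R) :
  uncovered P z -> uncovered (transpose P) (z.2, z.1).
Proof.
move=> N l b h /largest_transpose; rewrite transposeK /= -surjective_pairing => B.
have [N1 N2] := N _ _ _ B; split=> -[].
  by move=> /blocked_left_transpose ? /blocked_bottom_transpose ?; apply: N1.
by move=> /blocked_top_transpose ? /blocked_right_transpose ?; apply: N2.
Qed.

Lemma uncovered_top (R : realType) (P : seq (R * R)) z (l b h : R) :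
  uncovered P z -> largest P z l b h -> blocked_top P l b h ->
  blocked_bottom P l b h /\ ~ blocked_left P l b h.
Proof.
move=> N B T; have [N1 N2] := N _ _ _ B.
have [Bo|Ri] := largest_bottom_right B; last by case: N2.
by split=> // L; apply: N1.
Qed.

(** Otherwise slide right until the left side reaches [q]; the square keeps [z]. It ends blocked
    above and on the right, or with [q] as its upper left corner, where [q] blocks the left side
    too. *)
Lemma uncovered_top_point (R : realType) (P : seq (R * R)) z (l b h : R) q :
  uncovered P z -> largest P z l b h ->
  q \in P -> q.2 = b + h -> l <= q.1 -> q.1 < l + h -> z.1 < q.1.
Proof.
move=> N B qP q2 ql qr; rewrite ltNge; apply/negP => qz.
have [G C M] := B.
have [l' [ll' l'q G' st]] := slide_right G ql.
have B' : largest P z l' b h by split=> //; crush.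
have T' : blocked_top P l' b h by right; exists q => //; crush.
case: st => [E|Ri]; last by have [_ []] := N _ _ _ B'.
have [_] := uncovered_top N B' T'; apply; right; exists q => //.
by case: G => -[]; crush.
Qed.

Lemma uncovered_bottom_point (R : realType) (P : seq (R * R)) z (l b h : R) q :
  uncovered P z -> largest P z l b h ->
  q \in P -> q.2 = b -> l < q.1 -> q.1 <= l + h -> q.1 < z.1.
Proof.
move=> /uncovered_half_turn N /largest_half_turn B /mem_half_turn qP q2 ql qr.
have := uncovered_top_point N B qP; rewrite /= => H.
suff: 1 - z.1 < 1 - q.1 by lra.
by apply: H; lra.
Qed.

(** Slide right until the left side reaches [z]. Points blocking the top lie to the right of [z], so
    they keep blocking it and the right side stays free; a point blocking the bottom would lie both
    left and right of [z]. *)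
Lemma uncovered_top_floor (R : realType) (P : seq (R * R)) z (l b h : R) :
  uncovered P z -> largest P z l b h -> blocked_top P l b h -> b = 0.
Proof.
move=> N B T; have [G C M] := B.
have lz : l <= z.1 by case: C.
have [l' [ll' l'z G' st]] := slide_right G lz.
have B' : largest P z l' b h by split=> //; crush.
have T' : blocked_top P l' b h.
  case: T => [?|[q qP [q2 ql qr]]]; [by left|right; exists q => //].
  by have := uncovered_top_point N B qP q2 ql qr; crush.
case: st => [E|Ri]; last by have [_ []] := N _ _ _ B'.
have [[//|[p pP [p2 pl pr]]] _] := uncovered_top N B' T'.
by have := uncovered_bottom_point N B' pP p2 pl pr; crush.
Qed.

(** The previous lemma and its half turn give [b = 0] and [b + h = 1], so the square is the whole
    unit square and the wall blocks its left side. *)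
Lemma uncovered_not_top (R : realType) (P : seq (R * R)) z (l b h : R) :
  uncovered P z -> largest P z l b h -> ~ blocked_top P l b h.
Proof.
move=> N B T; have [Bo L] := uncovered_top N B T.
have b0 := uncovered_top_floor N B T.
have T' : blocked_top (half_turn P) (1 - l - h) (1 - b - h) h.
  by apply: blocked_bottom_half_turn; rewrite half_turnK.
have E := uncovered_top_floor (uncovered_half_turn N) (largest_half_turn B) T'.
by apply: L; left; case: B => -[Q _] _ _; crush.
Qed.

Lemma largest_not_uncovered (R : realType) (P : seq (R * R)) z (l b h : R) :
  largest P z l b h -> ~ uncovered P z.
Proof.
move=> B N; have [L|T] := largest_left_top B; last exact: (uncovered_not_top N B T).
have [Bo|Ri] := largest_bottom_right B.
  by have [N1 _] := N _ _ _ B; apply: N1.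
apply: (uncovered_not_top (uncovered_transpose N) (largest_transpose B)).
apply: blocked_right_transpose.
by rewrite transposeK.
Qed.

(** * Existence of a largest empty square *)

(** A square with corner [z], pointing towards the centre and no larger than the gap around the
    coordinates of [z], is empty. *)
Lemma good_small (R : realType) (P : seq (R * R)) (z : R * R) :
  0 <= z.1 <= 1 -> 0 <= z.2 <= 1 ->
  exists l b h, good P l b h /\ contains z l b h.
Proof.
move=> z1 z2; have [e e0 H] := coordinate_gap P z.1 z.1 z.2 z.2.
set d := Num.min e (1 / 2).
have d0 : 0 < d by rewrite lt_min e0/=; lra.
have de : d <= e by rewrite ge_min lexx.
have d2 : d <= 1 / 2 by rewrite ge_min lexx orbT.
exists (if z.1 <= 1 / 2 then z.1 else z.1 - d).
exists (if z.2 <= 1 / 2 then z.2 else z.2 - d).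
exists d; rewrite /good /contains; clearbody d.
have [z1h|z1h] := leP z.1 (1 / 2); have [z2h|z2h] := leP z.2 (1 / 2);
  (split; [split; [split; lra|]|split; lra]);
  move=> p /H[H1 H2 H3 H4] [p1 p2 p3 p4].
- by have := H2; lra.
- by have := H2; lra.
- by have := H4; lra.
- by have := H1; lra.
Qed.

Lemma closed_le_fun (T : topologicalType) (R : realType) (f g : T -> R) :
  continuous f -> continuous g -> closed [set x | f x <= g x].
Proof.
move=> cf cg.
have -> : [set x | f x <= g x] = (fun x => g x - f x) @^-1` [set y | 0 <= y].
  by apply/seteqP; split=> x /=; rewrite subr_ge0.
apply: preimage_closed; last exact: closed_ge.
by move=> x _; apply: cvgB; [exact: cg|exact: cf].
Qed.

(** The side is maximised over a compact set of triples: [0 < h] is relaxed to [0 <= h], and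
    emptiness becomes the closed condition [E]. The maximum is positive because [good_small]
    supplies a competitor. *)
Lemma largest_exists (R : realType) (P : seq (R * R)) (z : R * R) :
  0 <= z.1 <= 1 -> 0 <= z.2 <= 1 -> exists l b h, largest P z l b h.
Proof.
move=> z1 z2; have [l0 [b0 [h0 [G0 C0]]]] := good_small P z1 z2.
pose L (q : R * R * R) := q.1.1; pose B (q : R * R * R) := q.1.2.
pose H (q : R * R * R) := q.2.
have cL : continuous L by move=> q; apply: (@continuous_comp _ _ _ fst fst); exact: cvg_fst.
have cB : continuous B by move=> q; apply: (@continuous_comp _ _ _ fst snd); [exact: cvg_fst|exact: cvg_snd].
have cH : continuous H by move=> q; exact: cvg_snd.
have cLH : continuous (fun q => L q + H q) by move=> q; exact: (continuousD (cL q) (cH q)).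
have cBH : continuous (fun q => B q + H q) by move=> q; exact: (continuousD (cB q) (cH q)).
have cc (c : R) : continuous (fun _ : R * R * R => c) by move=> q; exact: cvg_cst.
pose E (p : R * R) := [set q | L q + H q <= p.1] `|` [set q | p.1 <= L q] `|`
            [set q | B q + H q <= p.2] `|` [set q | p.2 <= B q].
pose K : set (R * R * R) := [set q | 0 <= L q] `&` [set q | 0 <= B q] `&`
  [set q | 0 <= H q] `&` [set q | L q + H q <= 1] `&` [set q | B q + H q <= 1] `&`
  [set q | L q <= z.1] `&` [set q | z.1 <= L q + H q] `&`
  [set q | B q <= z.2] `&` [set q | z.2 <= B q + H q] `&`
  \bigcap_(p in [set` P]) E p.
have K_good l b h : good P l b h -> contains z l b h -> K (l, b, h).
  move=> [Q F] C; split; first by do 8?split; rewrite /= /L /B /H /=; crush.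
  move=> p /F nF; rewrite /E /L /B /H /=; apply: contrapT => N; apply: nF.
  by split; rewrite ltNge; apply/negP => ?; apply: N; [left; left; right|left; left; left|right|left; right].
have K0 : K !=set0 by exists (l0, b0, h0); exact: K_good.
have clK : closed K.
  do 9?apply: closedI; try by apply: closed_le_fun.
  apply: (@closed_bigI _ _ _ E) => p _.
  by rewrite /E; do 3?apply: closedU; apply: closed_le_fun.
have cK : compact K.
  apply: (@subclosed_compact _ K (`[0, 1]%classic `*` `[0, 1]%classic `*` `[0, 1]%classic)) => //.
    by do 2?apply: compact_setX; exact: segment_compact.
  move=> [[l b] h]; rewrite /K /L /B /H /= => -[[[[[[[[[]]]]]]]]] *.
  by rewrite /= !in_itv /=; repeat split; apply/andP; split; lra.
have [|[[l b] h] Kc Mc] := compact_EVT_max K0 cK (f := H).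
  exact: continuous_subspaceT.
have Mx l' b' h' : good P l' b' h' -> contains z l' b' h' -> h' <= h.
  by move=> G C; apply: (Mc (l', b', h')); rewrite inE; apply: K_good.
exists l, b, h; move: Kc; rewrite inE /K /L /B /H /= => -[[[[[[[[[]]]]]]]]] *.
have h0h := Mx _ _ _ G0 C0.
split=> //; split; first by case: G0 => Q _; crush.
move=> p pP [p1 p2 p3 p4].
by have /(_ p pP) : (\bigcap_(p in [set` P]) E p) (l, b, h) by []; rewrite /E /L /B /H /= => -[[[]|]|]; lra.
Qed.

Lemma covered (R : realType) (P : seq (R * R)) (z : R * R) :
  0 <= z.1 <= 1 -> 0 <= z.2 <= 1 ->
  exists l b h, [/\ good P l b h, contains z l b h &
    (blocked_left P l b h /\ blocked_bottom P l b h) \/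
    (blocked_top P l b h /\ blocked_right P l b h)].
Proof.
move=> z1 z2; have [l [b [h B]]] := largest_exists P z1 z2.
apply: contrapT => N; apply: (largest_not_uncovered B) => l' b' h' [G C _].
by split=> ?; apply: N; exists l', b', h'; split=> //; [left|right].
Qed.

(** * Chains of empty squares and their hulls *)

Definition chain (R : realType) (P : seq (R * R)) (C : R -> R -> R -> Prop) : Prop :=
  (forall l b h, C l b h -> good P l b h) /\
  (forall l b h l' b' h', C l b h -> C l' b' h' ->
    inside l b h l' b' h' \/ inside l' b' h' l b h).

Lemma chain_join (R : realType) (P : seq (R * R)) C (l b h l' b' h' : R) :
  chain P C -> C l b h -> C l' b' h' ->
  exists l'' b'' h'', [/\ C l'' b'' h'', inside l b h l'' b'' h'' &
                          inside l' b' h' l'' b'' h''].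
Proof.
move=> [_ N] c c'; case: (N _ _ _ _ _ _ c c') => I.
  by exists l', b', h'; split=> //; split.
by exists l, b, h; split=> //; split.
Qed.

(** The hull takes the infima of [l] and [b] and the supremum of [h]; it need not belong to the
    chain. A point in its interior satisfies strict inequalities each of which holds for some
    member, hence all hold for a common larger member. *)
Lemma chain_hull (R : realType) (P : seq (R * R)) C (l0 b0 h0 : R) :
  chain P C -> C l0 b0 h0 ->
  exists l b h, good P l b h /\ forall l' b' h', C l' b' h' -> inside l' b' h' l b h.
Proof.
move=> CC c0; have [G N] := CC.
pose L := [set l | exists b h, C l b h].
pose B := [set b | exists l h, C l b h].
pose H := [set h | exists l b, C l b h].
have iL : has_inf L.
  split; first by exists l0, b0, h0.
  by exists 0 => l [b [h /G[Q _]]]; crush.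
have iB : has_inf B.
  split; first by exists b0, l0, h0.
  by exists 0 => b [l [h /G[Q _]]]; crush.
have sH : has_sup H.
  split; first by exists h0, l0, b0.
  by exists 1 => h [l [b /G[Q _]]]; crush.
set ll := inf L; set bb := inf B; set hh := sup H.
have lel l b h : C l b h -> ll <= l.
  by move=> c; apply: ge_inf; [exact: iL.2|exists b, h].
have leb l b h : C l b h -> bb <= b.
  by move=> c; apply: ge_inf; [exact: iB.2|exists l, h].
have leh l b h : C l b h -> h <= hh.
  by move=> c; apply: ub_le_sup; [exact: sH.2|exists l, b].
have exl x : ll < x -> exists l b h, C l b h /\ l < x.
  move=> llx; have [|l [b [h c]] lt] := @inf_adherent _ L (x - ll) _ iL; first lra.
  by exists l, b, h; split=> //; move: lt; rewrite -/ll; lra.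
have exb x : bb < x -> exists l b h, C l b h /\ b < x.
  move=> bbx; have [|b [l [h c]] lt] := @inf_adherent _ B (x - bb) _ iB; first lra.
  by exists l, b, h; split=> //; move: lt; rewrite -/bb; lra.
have exh x : x < hh -> exists l b h, C l b h /\ x < h.
  move=> xhh; have [|h [l [b c]] lt] := @sup_adherent _ H (hh - x) _ sH; first lra.
  by exists l, b, h; split=> //; move: lt; rewrite -/hh; lra.
clearbody ll bb hh.
(* A member reaching beyond [ll + hh] could not be compared with a member lying far enough to the
   left. *)
have ler l b h : C l b h -> l + h <= ll + hh.
  move=> c; rewrite leNgt; apply/negP => lt.
  have [|l' [b' [h' [c' l'l]]]] := exl (l - (hh - h)); first lra.
  have := lel _ _ _ c; have := leh _ _ _ c; have := leh _ _ _ c'.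
  by case: (N _ _ _ _ _ _ c c'); crush.
have let_ l b h : C l b h -> b + h <= bb + hh.
  move=> c; rewrite leNgt; apply/negP => lt.
  have [|l' [b' [h' [c' b'b]]]] := exb (b - (hh - h)); first lra.
  have := leb _ _ _ c; have := leh _ _ _ c; have := leh _ _ _ c'.
  by case: (N _ _ _ _ _ _ c c'); crush.
exists ll, bb, hh; split; last first.
  by move=> l b h c; split; [exact: lel c|exact: ler c|exact: leb c|exact: let_ c].
split.
  have hh0 : 0 < hh by have := leh _ _ _ c0; have [Q _] := G _ _ _ c0; crush.
  split=> //.
  - rewrite leNgt; apply/negP => /exl[l [b [h [/G[Q _] ?]]]]; crush.
  - rewrite leNgt; apply/negP => lt.
    have [|l [b [h [c ?]]]] := exh (1 - ll); first lra.
    by have := lel _ _ _ c; have [Q _] := G _ _ _ c; crush.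
  - rewrite leNgt; apply/negP => /exb[l [b [h [/G[Q _] ?]]]]; crush.
  - rewrite leNgt; apply/negP => lt.
    have [|l [b [h [c ?]]]] := exh (1 - bb); first lra.
    by have := leb _ _ _ c; have [Q _] := G _ _ _ c; crush.
move=> p pP [p1 p2 p3 p4].
have [l1 [b1 [h1 [c1 lt1]]]] := exl _ p1.
have [l2 [b2 [h2 [c2 lt2]]]] := exb _ p3.
(* As [ll <= l3] and [bb <= b3], a side above this maximum puts both the right side and the top
   beyond [p]. *)
have [|l3 [b3 [h3 [c3 lt3]]]] := exh (Num.max (p.1 - ll) (p.2 - bb)).
  by rewrite gt_max; apply/andP; split; lra.
move: lt3; rewrite gt_max => /andP[lt3 lt4].
have [l4 [b4 [h4 [c4 I1 I2]]]] := chain_join CC c1 c2.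
have [l5 [b5 [h5 [c5 I3 I4]]]] := chain_join CC c3 c4.
have [_ /(_ p pP)] := G _ _ _ c5; apply.
have := lel _ _ _ c3; have := leb _ _ _ c3.
rewrite /inside in I1 I2 I3 I4.
by crush.
Qed.

(** Each nonempty chain contributes its hull and an empty chain nothing. The default of [nth] is the
    empty family, so indices past the end demand nothing. *)
Lemma chains_cover (R : realType) (P : seq (R * R)) (Cs : seq (R -> R -> R -> Prop)) :
  (forall i, (i < size Cs)%N -> chain P (nth (fun _ _ _ => False) Cs i)) ->
  exists Q : seq (R * R * R), [/\ (size Q <= size Cs)%N,
    forall l b h, (l, b, h) \in Q -> good P l b h &
    forall i l b h, nth (fun _ _ _ => False) Cs i l b h ->
      exists l' b' h', (l', b', h') \in Q /\ inside l b h l' b' h'].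
Proof.
elim: Cs => [|C Cs IH] CC; first by exists [::]; split=> // -[].
have [|Q [sQ gQ cQ]] := IH; first by move=> i; exact: (CC i.+1).
have [[l0 [b0 [h0 c0]]]|NC] := pselect (exists l b h, C l b h).
  have [l [b [h [G I]]]] := chain_hull (CC 0%N isT) c0.
  exists ((l, b, h) :: Q); split=> //.
    by move=> l' b' h' /[!inE]/orP[/eqP[-> -> ->]//|]; exact: gQ.
  move=> [|i] l' b' h'.
    by move=> /I ?; exists l, b, h; rewrite inE eqxx.
  by move=> /cQ[l'' [b'' [h'' [q I']]]]; exists l'', b'', h''; rewrite inE q orbT.
exists Q; split=> //; first exact: leqW.
move=> [|i] l' b' h'; last exact: cQ.
by move=> c; case: NC; exists l', b', h'.
Qed.

(** * The 2k + 2 chains and the covering of the unit square *)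

Definition chain_half_turn (R : realType) (C : R -> R -> R -> Prop) (l b h : R) : Prop :=
  C (1 - l - h) (1 - b - h) h.

Lemma chain_half_turnP (R : realType) (P : seq (R * R)) (C : R -> R -> R -> Prop) :
  chain (half_turn P) C -> chain P (chain_half_turn C).
Proof.
move=> [G N]; split.
  move=> l b h /G/good_half_turn; rewrite half_turnK.
  by congr (good _ _ _ _); lra.
move=> l b h l' b' h' c c'; rewrite /inside.
by case: (N _ _ _ _ _ _ c c') => I; [left|right]; rewrite /inside in I; crush.
Qed.

Definition corner_chain (R : realType) (P : seq (R * R)) (l b h : R) : Prop :=
  [/\ good P l b h, l = 0 & b = 0].

Lemma corner_chainP (R : realType) (P : seq (R * R)) : chain P (corner_chain P).
Proof.
split=> [l b h []//|l b h l' b' h' [_ -> ->] [_ -> ->]].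
by rewrite /inside; have [?|?] := leP h h'; [left|right]; split; lra.
Qed.

(* Squares on the upper left of p that are charged to p.  For two squares of different kinds to be
   comparable, exactly one of the two slope conditions has to be strict. *)
Definition point_chain (R : realType) (P : seq (R * R)) (p : R * R) (l b h : R) : Prop :=
  good P l b h /\
  ([/\ p.2 = b, l <= p.1, p.1 <= l + h & l = 0 \/ exists2 a, a \in P &
       [/\ a.1 = l, b < a.2, a.2 <= b + h & a.2 - p.2 <= p.1 - l]] \/
   [/\ p.1 = l + h, b <= p.2, p.2 <= b + h & b + h = 1 \/ exists2 a, a \in P &
       [/\ a.2 = b + h, l <= a.1, a.1 < l + h & p.1 - a.1 < b + h - p.2]]).

(** Call reach the extent to the left of [p] for a square standing on [p], and the extent above [p]
    for a square ending at [p] on the right. The square of smaller reach has a wall or a point [a]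
    on its far side; a wall would stop the other square as well, and the slope condition puts [a]
    inside the other. So the reaches agree, and then the squares are nested. *)
Lemma point_chainP (R : realType) (P : seq (R * R)) (p : R * R) : chain P (point_chain P p).
Proof.
split=> [l b h []//|].
have AB l b h l' b' h' : good P l b h -> good P l' b' h' ->
    [/\ p.2 = b, l <= p.1, p.1 <= l + h & l = 0 \/ exists2 a, a \in P &
       [/\ a.1 = l, b < a.2, a.2 <= b + h & a.2 - p.2 <= p.1 - l]] ->
    [/\ p.1 = l' + h', b' <= p.2, p.2 <= b' + h' & b' + h' = 1 \/ exists2 a, a \in P &
       [/\ a.2 = b' + h', l' <= a.1, a.1 < l' + h' & p.1 - a.1 < b' + h' - p.2]] ->
    inside l b h l' b' h' \/ inside l' b' h' l b h.
  move=> [[h0 l0 r1 b0 t1] F] [[h'0 l'0 r'1 b'0 t'1] F'] [pb pl pr A] [pr' pb' pt' B].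
  rewrite /inside.
  have [lt|lt|E] := ltgtP (p.1 - l) (b' + h' - p.2).
  - case: A => [A|[a aP A]]; first by lra.
    by exfalso; apply: (F' a aP); crush.
  - case: B => [B|[a aP B]]; first by lra.
    by exfalso; apply: (F a aP); crush.
  (* Equal reaches: the strict slope condition puts [a] to the right of [l], so the first square
     rises no higher than [a] or the wall and lies in the second. *)
  - left; case: B => [B|[a aP B]]; first by split; lra.
    have [H|H] := leP (b + h) a.2; first by crush.
    by exfalso; apply: (F a aP); crush.
move=> l b h l' b' h' [g [c|c]] [g' [c'|c']]; last first.
- move: g g' c c' => [[h0 l0 r1 b0 t1] F] [[h'0 l'0 r'1 b'0 t'1] F'] [pr pb pt A] [pr' pb' pt' A'].
  rewrite /inside.
  have [lt|lt|E] := ltgtP (b + h) (b' + h').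
  + case: A => [A|[a aP A]]; first by lra.
    by exfalso; apply: (F' a aP); crush.
  + case: A' => [A'|[a aP A']]; first by lra.
    by exfalso; apply: (F a aP); crush.
  + by clear A A'; have [?|?] := leP h h'; [left|right]; split; lra.
- by have [?|?] := AB _ _ _ _ _ _ g' g c' c; [right|left].
- exact: AB.
- move: g g' c c' => [[h0 l0 r1 b0 t1] F] [[h'0 l'0 r'1 b'0 t'1] F'] [pb pl pr A] [pb' pl' pr' A'].
  rewrite /inside.
  have [lt|lt|E] := ltgtP l l'.
  + case: A' => [A'|[a aP A']]; first by lra.
    by exfalso; apply: (F a aP); crush.
  + case: A => [A|[a aP A]]; first by lra.
    by exfalso; apply: (F' a aP); crush.
  + by clear A A'; have [?|?] := leP h h'; [left|right]; split; lra.
Qed.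

Definition in_chains (R : realType) (P : seq (R * R)) (l b h : R) : Prop :=
  corner_chain P l b h \/
  exists2 p, p \in P & point_chain P p l b h \/
    chain_half_turn (point_chain (half_turn P) (1 - p.1, 1 - p.2)) l b h.

(** This is the charging rule. The test [a.2 - b <= p.1 - l] says that [a] does not exceed [p] in
    [x + y]. When it fails, the half turn makes [a] the strictly smaller blocker of a square blocked
    above and on the right. If one blocker is a wall, the other takes the charge. *)
Lemma in_chains_left_bottom (R : realType) (P : seq (R * R)) (l b h : R) :
  good P l b h -> blocked_left P l b h -> blocked_bottom P l b h -> in_chains P l b h.
Proof.
move=> G.
have G' : good (half_turn P) (1 - l - h) (1 - b - h) h by exact: good_half_turn.
move=> [l0|[a aP A]] [b0|[p pP B]].
- by left.
- right; exists p => //; left; split=> //; left.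
  by split; try crush; left.
- right; exists a => //; right; split=> //; right.
  by split; try crush; left; lra.
- have [le|lt] := leP (a.2 - b) (p.1 - l).
    right; exists p => //; left; split=> //; left.
    by split; try crush; right; exists a => //; crush.
  right; exists a => //; right; split=> //; right.
  split; try by crush.
  by right; exists (1 - p.1, 1 - p.2); [exact: mem_half_turn|crush].
Qed.

Lemma square_cover (R : realType) (P : seq (R * R)) :
  exists Q : seq (R * R * R), [/\ (size Q <= 2 * size P + 2)%N,
    forall l b h, (l, b, h) \in Q -> good P l b h &
    forall z, 0 <= z.1 <= 1 -> 0 <= z.2 <= 1 ->
      exists l b h, (l, b, h) \in Q /\ contains z l b h].
Proof.
pose br p := chain_half_turn (point_chain (half_turn P) (1 - p.1, 1 - p.2)).
(* Two corners and two sides of each point; the index shifts below follow this order. *)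
pose Cs := corner_chain P :: chain_half_turn (corner_chain (half_turn P)) ::
  map (point_chain P) P ++ map br P.
have sCs : size Cs = (2 * size P + 2)%N.
  by rewrite /= size_cat !size_map mul2n -addnn addn2.
have nthE i : nth (fun _ _ _ => False) (map (point_chain P) P ++ map br P) i =
    if (i < size P)%N then point_chain P (nth (0, 0) P i) else
    if (i - size P < size P)%N then br (nth (0, 0) P (i - size P)) else fun _ _ _ => False.
  rewrite nth_cat size_map; case: ifP => iP; first by rewrite (nth_map (0, 0)).
  case: ifP => iP'; first by rewrite (nth_map (0, 0)).
  by rewrite nth_default// size_map leqNgt iP'.
have [|Q [sQ gQ cQ]] := @chains_cover R P Cs.
  case=> [_|[_|i]]; [exact: corner_chainP|apply: chain_half_turnP; exact: corner_chainP|].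
  rewrite sCs addn2 !ltnS => iP; rewrite /= nthE.
  case: ifP => iP'; first exact: point_chainP.
  case: ifP => iP''; first by apply: chain_half_turnP; exact: point_chainP.
  by split.
exists Q; split=> //; first by rewrite -sCs.
have inQ l b h : in_chains P l b h ->
    exists l' b' h', (l', b', h') \in Q /\ inside l b h l' b' h'.
  move=> [c|[p pP [c|c]]]; first exact: (cQ 0%N).
    apply: (cQ (index p P).+2); rewrite /= nthE index_mem pP.
    by rewrite nth_index.
  apply: (cQ (index p P + size P).+2); rewrite /= nthE addnK index_mem pP.
  by rewrite ltnNge leq_addl /= nth_index.
(* The list of chains is invariant under the half turn, which reduces squares blocked above and on
   the right to the other kind. *)
have inQ' l b h : in_chains (half_turn P) (1 - l - h) (1 - b - h) h ->
    exists l' b' h', (l', b', h') \in Q /\ inside l b h l' b' h'.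
  have El : 1 - (1 - l - h) - h = l by lra.
  have Eb : 1 - (1 - b - h) - h = b by lra.
  move=> [c|[_ /half_turnP[q qP ->] [c|]]]; first exact: (cQ 1%N).
    by apply: inQ; right; exists q => //; right.
  rewrite /chain_half_turn El Eb half_turnK /= => c.
  apply: inQ; right; exists q => //; left; move: c.
  by congr (point_chain _ _ _ _ _); case: (q) => x y /=; congr (_, _); lra.
move=> z z1 z2; have [l [b [h [G C [[L Bo]|[T Ri]]]]]] := covered P z1 z2.
  have [l' [b' [h' [q I]]]] := inQ _ _ _ (in_chains_left_bottom G L Bo).
  by exists l', b', h'; split=> //; crush.
have [|l' [b' [h' [q I]]]] := inQ' l b h.
  apply: in_chains_left_bottom; first exact: good_half_turn.
    by apply: blocked_right_half_turn; rewrite half_turnK.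
  by apply: blocked_top_half_turn; rewrite half_turnK.
by exists l', b', h'; split=> //; crush.
Qed.

(** * Coordinates in the frame of a tilted square *)

Definition frame_pt (R : realType) (p u : 'rV[R]_2) (s t : R) : 'rV[R]_2 :=
  p + s *: u + t *: rot90 u.

Definition sqnorm (R : realType) (u : 'rV[R]_2) : R := u 0 0 ^+ 2 + u 0 1 ^+ 2.

(** The inner product of [x - p] with [u] over the squared length; [ordinate] uses [rot90 u]
    instead. *)
Definition abscissa (R : realType) (p u x : 'rV[R]_2) : R :=
  ((x 0 0 - p 0 0) * u 0 0 + (x 0 1 - p 0 1) * u 0 1) / sqnorm u.

Definition ordinate (R : realType) (p u x : 'rV[R]_2) : R :=
  ((x 0 1 - p 0 1) * u 0 0 - (x 0 0 - p 0 0) * u 0 1) / sqnorm u.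

Definition frame_square (R : realType) (p u : 'rV[R]_2) (l b h : R) : set 'rV[R]_2 :=
  [set x | contains (abscissa p u x, ordinate p u x) l b h].

Lemma row2P (R : realType) (x y : 'rV[R]_2) :
  x 0 0 = y 0 0 -> x 0 1 = y 0 1 -> x = y.
Proof.
move=> e0 e1; apply/rowP => j.
by case: j => -[|[|//]] j; [move: e0|move: e1]; congr (_ = _); congr (_ _ _); apply: val_inj.
Qed.

Lemma sqnorm_gt0 (R : realType) (u : 'rV[R]_2) : u != 0 -> 0 < sqnorm u.
Proof.
move=> u0; rewrite lt_neqAle addr_ge0 ?sqr_ge0// andbT eq_sym.
apply: contra u0; rewrite /sqnorm paddr_eq0 ?sqr_ge0// !sqrf_eq0 => /andP[/eqP e0 /eqP e1].
by apply/eqP/row2P; rewrite mxE.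
Qed.

Lemma frame_pt0 (R : realType) (p u : 'rV[R]_2) s t :
  frame_pt p u s t 0 0 = p 0 0 + s * u 0 0 - t * u 0 1.
Proof. by rewrite !mxE /= mulrN. Qed.

Lemma frame_pt1 (R : realType) (p u : 'rV[R]_2) s t :
  frame_pt p u s t 0 1 = p 0 1 + s * u 0 1 + t * u 0 0.
Proof. by rewrite !mxE. Qed.

Lemma frame_ptK (R : realType) (p u : 'rV[R]_2) s t : u != 0 ->
  abscissa p u (frame_pt p u s t) = s /\ ordinate p u (frame_pt p u s t) = t.
Proof.
move=> /sqnorm_gt0 N; rewrite /abscissa /ordinate frame_pt0 frame_pt1.
have {N} : sqnorm u != 0 by rewrite gt_eqF.
by rewrite /sqnorm => N; split; field.
Qed.

Lemma frame_coordinatesK (R : realType) (p u x : 'rV[R]_2) : u != 0 ->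
  frame_pt p u (abscissa p u x) (ordinate p u x) = x.
Proof.
move=> /sqnorm_gt0 N.
have {N} : sqnorm u != 0 by rewrite gt_eqF.
rewrite /abscissa /ordinate /sqnorm => N.
by apply: row2P; rewrite ?frame_pt0 ?frame_pt1; field.
Qed.

Lemma coordinate_continuous (R : realType) (p : 'rV[R]_2) (i : 'I_2) (w : R) :
  continuous (fun x : 'rV[R]_2 => (x 0 i - p 0 i) * w).
Proof.
move=> x.
have c : {for x, continuous (fun x : 'rV[R]_2 => x 0 i)} by exact: coord_continuous.
have k (a : R) : {for x, continuous (fun _ : 'rV[R]_2 => a)} by exact: cst_continuous.
exact: continuousM (continuousB c (k (p 0 i))) (k w).
Qed.

Lemma abscissa_continuous (R : realType) (p u : 'rV[R]_2) : continuous (abscissa p u).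
Proof.
move=> x; have c := @coordinate_continuous R p.
have k : {for x, continuous (fun _ : 'rV[R]_2 => (sqnorm u)^-1)} by exact: cst_continuous.
exact: continuousM (continuousD (c _ _ x) (c _ _ x)) k.
Qed.

Lemma ordinate_continuous (R : realType) (p u : 'rV[R]_2) : continuous (ordinate p u).
Proof.
move=> x; have c := @coordinate_continuous R p.
have k : {for x, continuous (fun _ : 'rV[R]_2 => (sqnorm u)^-1)} by exact: cst_continuous.
exact: continuousM (continuousB (c _ _ x) (c _ _ x)) k.
Qed.

Lemma frame_square_closed (R : realType) (p u : 'rV[R]_2) l b h :
  closed (frame_square p u l b h).
Proof.
have -> : frame_square p u l b h =
    [set x | l <= abscissa p u x] `&` [set x | abscissa p u x <= l + h] `&`
    [set x | b <= ordinate p u x] `&` [set x | ordinate p u x <= b + h].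
  apply/seteqP; split=> x; rewrite /frame_square /contains /=.
    by case.
  by move=> [[[]]].
have cA := @abscissa_continuous R p u; have cO := @ordinate_continuous R p u.
have cc (c : R) : continuous (fun _ : 'rV[R]_2 => c) by exact: cst_continuous.
exact: closedI (closedI (closedI (closed_le_fun (cc _) cA) (closed_le_fun cA (cc _)))
  (closed_le_fun (cc _) cO)) (closed_le_fun cO (cc _)).
Qed.

Lemma frame_square_interior (R : realType) (p u : 'rV[R]_2) l b h x : u != 0 ->
  interior (frame_square p u l b h) x <->
  [/\ l < abscissa p u x, abscissa p u x < l + h,
      b < ordinate p u x & ordinate p u x < b + h].
Proof.
move=> u0; split; last first.
  pose O := abscissa p u @^-1` [set s | l < s] `&` abscissa p u @^-1` [set s | s < l + h] `&`
    ordinate p u @^-1` [set s | b < s] `&` ordinate p u @^-1` [set s | s < b + h].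
  have oO : open O.
    have oA D : open D -> open (abscissa p u @^-1` D).
      by apply: open_comp => y _; exact: abscissa_continuous.
    have oB D : open D -> open (ordinate p u @^-1` D).
      by apply: open_comp => y _; exact: ordinate_continuous.
    apply: openI; first apply: openI; first apply: openI.
    - by apply: oA; exact: open_gt.
    - by apply: oA; exact: open_lt.
    - by apply: oB; exact: open_gt.
    - by apply: oB; exact: open_lt.
  move=> [x1 x2 x3 x4].
  have : O `<=` interior (frame_square p u l b h).
    rewrite -open_subsetE// => y [[[/= y1 y2] y3] y4].
    by split; apply: ltW.
  by apply.
move=> ix.
(* Diagonal motion shifts both coordinates at once, so two points, at [e / 2] and [- (e / 2)], give
   all four strict inequalities. *)
pose g (e : R) := frame_pt p u (abscissa p u x + e) (ordinate p u x + e).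
have cg : {for 0, continuous g}.
  have -> : g = (fun=> x) + (fun e => e *: (u + rot90 u)).
    apply/funext => e; rewrite -[x in RHS](@frame_coordinatesK R p u)//.
    by apply: row2P; rewrite /g !mxE /=; ring.
  by apply: continuousD; [exact: cst_continuous|exact: scalel_continuous].
have : nbhs (g 0) (frame_square p u l b h).
  by rewrite /g !addr0 frame_coordinatesK//.
move=> /cg /nbhs_ballP[e /= e0 H].
have He d : `|d| < e -> frame_square p u l b h (g d).
  by move=> de; apply: H; rewrite /ball /= sub0r normrN.
have e2 : `|e / 2| < e by rewrite ger0_norm; lra.
have e2N : `|- (e / 2)| < e by rewrite normrN.
have := He _ e2; have := He _ e2N; rewrite /frame_square /contains /= /g.
have [-> ->] := frame_ptK p (abscissa p u x - e / 2) (ordinate p u x - e / 2) u0.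
have [-> ->] := frame_ptK p (abscissa p u x + e / 2) (ordinate p u x + e / 2) u0.
by move=> [? ? ? ?] [? ? ? ?]; split; lra.
Qed.

Lemma frame_squareE (R : realType) (p u : 'rV[R]_2) l b h : u != 0 -> 0 < h ->
  frame_square p u l b h =
  [set x | exists s t : R, [/\ 0 <= s <= 1, 0 <= t <= 1 &
     x = frame_pt p u l b + s *: (h *: u) + t *: rot90 (h *: u)]].
Proof.
move=> u0 h0.
have E s t : frame_pt p u l b + s *: (h *: u) + t *: rot90 (h *: u) =
    frame_pt p u (l + s * h) (b + t * h).
  apply: row2P; rewrite ?frame_pt0 ?frame_pt1 !mxE /=; ring.
apply/seteqP; split=> x; rewrite /frame_square /contains /=.
  move=> [x1 x2 x3 x4].
  exists ((abscissa p u x - l) / h), ((ordinate p u x - b) / h); split.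
  - by apply/andP; split; [apply: divr_ge0; lra|rewrite ler_pdivrMr//; lra].
  - by apply/andP; split; [apply: divr_ge0; lra|rewrite ler_pdivrMr//; lra].
  - by rewrite E !divfK ?gt_eqF// !subrKC frame_coordinatesK.
move=> [s [t [s01 t01 ->]]]; rewrite E.
have [-> ->] := frame_ptK p (l + s * h) (b + t * h) u0.
by split; nra.
Qed.

(** * Homothets of a square in frame coordinates *)

Definition square_at (R : realType) (p u : 'rV[R]_2) : set 'rV[R]_2 :=
  [set x | exists s t : R, [/\ 0 <= s <= 1, 0 <= t <= 1 &
     x = p + s *: u + t *: rot90 u]].

Lemma homothet_square_at (R : realType) (p u : 'rV[R]_2) m w :
  homothet (square_at p u) m w = square_at (m *: p + w) (m *: u).
Proof.
have E s t : m *: (p + s *: u + t *: rot90 u) + w =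
    m *: p + w + s *: (m *: u) + t *: rot90 (m *: u).
  by apply: row2P; rewrite !mxE /=; ring.
apply/seteqP; split=> [_ [_ [s [t [s01 t01 ->]]] <-]|_ [s [t [s01 t01 ->]]]].
  by exists s, t; rewrite E.
by exists (p + s *: u + t *: rot90 u); [exists s, t|rewrite E].
Qed.

(** The normalisation: in the frame of [S] itself, [S] is the unit square and the family consists of
    all squares parallel to the frame. *)
Lemma homothets_frame (R : realType) (C S : set 'rV[R]_2) :
  is_closed_square C -> homothets C S ->
  exists p u, [/\ u != 0, S = frame_square p u 0 0 1 &
    forall X, homothets C X <-> exists l b h, 0 < h /\ X = frame_square p u l b h].
Proof.
move=> [p0 [u0 [u00 ->]]] [m [v [m0 ->]]]; rewrite -/(square_at p0 u0).
have mu : m *: u0 != 0 by rewrite scaler_eq0 (gt_eqF m0).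
exists (m *: p0 + v), (m *: u0); split=> //.
  rewrite homothet_square_at frame_squareE// /square_at scale1r.
  by rewrite /frame_pt !scale0r !addr0.
move=> X; split.
  move=> [n [w [n0 ->]]]; rewrite homothet_square_at.
  set p := m *: p0 + v; set u := m *: u0.
  exists (abscissa p u (n *: p0 + w)), (ordinate p u (n *: p0 + w)), (n / m).
  split; first exact: divr_gt0.
  rewrite frame_squareE ?divr_gt0// frame_coordinatesK//.
  by rewrite /u scalerA divfK ?gt_eqF.
move=> [l [b [h [h0 ->]]]]; rewrite frame_squareE//.
set p := m *: p0 + v.
(* [C] has edge [u0] and the frame has edge [m *: u0], hence the factors [h * m] here and [n / m]
   above. *)
exists (h * m), (frame_pt p (m *: u0) l b - (h * m) *: p0).
split; first exact: mulr_gt0.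
by rewrite homothet_square_at addrC subrK scalerA.
Qed.

Lemma unit_frame_squareP (R : realType) (p u : 'rV[R]_2) l b h : u != 0 -> 0 < h ->
  frame_square p u l b h `<=` frame_square p u 0 0 1 ->
  [/\ 0 <= l, l + h <= 1, 0 <= b & b + h <= 1].
Proof.
move=> u0 h0 sub.
have H s t : l <= s <= l + h -> b <= t <= b + h -> [/\ 0 <= s, s <= 0 + 1, 0 <= t & t <= 0 + 1].
  move=> s1 t1; have := sub (frame_pt p u s t); rewrite /frame_square /contains /=.
  by have [-> ->] := frame_ptK p s t u0; apply; split; lra.
by have [||] := H l b; try lra; have [||] := H (l + h) (b + h); try lra; split; lra.
Qed.

Lemma homothets_closed (R : realType) (C S : set 'rV[R]_2) :
  is_closed_square C -> homothets C S -> closed S.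
Proof.
by move=> hC /(homothets_frame hC)[p [u [_ -> _]]]; exact: frame_square_closed.
Qed.

(** * Upper bound *)

Lemma self_coverability_square (R : realType) (C : set 'rV[R]_2) :
  is_closed_square C ->
  self_coverability_function (homothets C) (fun k : nat => (2 * k + 2)%N).
Proof.
move=> hC S P k hS PS Pk.
have [p [u [u0 ES HC]]] := homothets_frame hC hS.
have [f [fP _ Pf]] : exists f, set_bij `I_k P f by apply/card_set_bijP; rewrite card_eq_sym.
pose Pc := [seq (abscissa p u (f i), ordinate p u (f i)) | i <- iota 0 k].
have [Q [sQ gQ cQ]] := square_cover Pc.
rewrite size_map size_iota in sQ.
pose G i : set 'rV[R]_2 := let q := nth (0, 0, 0) Q i in frame_square p u q.1.1 q.1.2 q.2.
exists (G @` `I_(size Q)).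
have GP i : (i < size Q)%N -> exists l b h, good Pc l b h /\ G i = frame_square p u l b h.
  move=> iQ; rewrite /G; have := mem_nth (0, 0, 0) iQ.
  case: (nth _ _ _) => -[l b] h /gQ g; by exists l, b, h.
split.
- move=> _ [i /= iQ <-]; have [l [b [h [[[h0 _ _ _ _] _] ->]]]] := GP _ iQ.
  by apply/HC; exists l, b, h.
- by apply: (card_le_trans (card_image_le _ _)); rewrite card_le_II.
- rewrite ES; apply/seteqP; split.
    move=> x [_ [i /= iQ <-]]; have [l [b [h [[Qs _] ->]]]] := GP _ iQ.
    rewrite /frame_square /=; crush.
  move=> x; rewrite /frame_square /= => xS.
  have [||l [b [h [q c]]]] := cQ (abscissa p u x, ordinate p u x); [by crush|by crush|].
  exists (G (index (l, b, h) Q)).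
    by exists (index (l, b, h) Q) => //=; rewrite index_mem.
  by rewrite /G nth_index.
- move=> _ y [i /= iQ <-] Py; have [l [b [h [[_ F] ->]]]] := GP _ iQ.
  move=> /(frame_square_interior _ _ _ _ _ u0); apply: (F (_, _)).
  have [j jk <-] := Pf _ Py.
  by apply/mapP; exists j => //; rewrite mem_iota.
Qed.

(** * Lower bound *)

Definition wall_mark (R : realType) (k m : nat) : R :=
  if m == 0%N then 0 else 3 ^+ m / 3 ^+ k.

(** A ratio above 2 makes the distance between two marks exceed half of the larger one. *)
Lemma wall_mark_step (R : realType) (k i j : nat) :
  (i < j)%N -> wall_mark R k i <= wall_mark R k j / 3 /\ 0 < wall_mark R k j.
Proof.
move=> ij; rewrite /wall_mark; case: j ij => //= j; rewrite ltnS => ij.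
have p n : (0 : R) < 3 ^+ n by apply: exprn_gt0; lra.
split; last exact: divr_gt0.
case: eqP => _; first by rewrite !mulr_ge0 ?invr_ge0 ?ltW.
rewrite mulrAC ler_pM2r ?invr_gt0// exprS mulrC mulKf ?pnatr_eq0//.
by rewrite ler_weXn2l//; lra.
Qed.

Lemma wall_mark_top (R : realType) (k : nat) : (0 < k)%N -> wall_mark R k k = 1.
Proof.
by case: k => // k _; rewrite /wall_mark /= divff// expf_neq0// pnatr_eq0.
Qed.

(* Points of the boundary of [0, 1]^2 no two of which lie in a common empty square. *)
Definition witness (R : realType) (k i : nat) : R * R :=
  if (i <= k)%N then (0, wall_mark R k i)
  else if (i <= 2 * k)%N then (wall_mark R k (i - k), 0) else (1, 1).

Lemma witness_in_unit (R : realType) (k i : nat) : (0 < k)%N ->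
  0 <= (witness R k i).1 <= 1 /\ 0 <= (witness R k i).2 <= 1.
Proof.
move=> k0; have w1 := wall_mark_top R k0.
have w01 m : (m <= k)%N -> 0 <= wall_mark R k m <= 1.
  rewrite leq_eqVlt => /orP[/eqP->|/(wall_mark_step R k)[+ _]]; first by rewrite w1; lra.
  have : 0 <= wall_mark R k m.
    by rewrite /wall_mark; case: eqP => // _; rewrite divr_ge0// exprn_ge0.
  by rewrite w1; lra.
rewrite /witness; case: leqP => ik /=.
  by split; [lra|exact: w01].
case: leqP => ik2 /=; last by split; lra.
by split; [apply: w01; lia|lra].
Qed.

(** Let [w] be the mark of the later witness, with [w = 1] for [(1, 1)]. A subsquare through both
    witnesses meets the left or bottom wall and is so large that [(w / 2, w / 2)] lies in its
    interior. *)
Lemma witness_separated (R : realType) (k i j : nat) (l b h : R) :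
  (0 < k)%N -> (i < j < 2 * k + 2)%N ->
  [/\ 0 <= l, l + h <= 1, 0 <= b & b + h <= 1] ->
  (forall m, (m < k)%N -> let d := wall_mark R k m.+1 / 2 in
    ~ [/\ l < d, d < l + h, b < d & d < b + h]) ->
  contains (witness R k i) l b h -> contains (witness R k j) l b h -> False.
Proof.
move=> k0 /andP[ij j2] Qs F; have w1 := wall_mark_top R k0.
have st m n := @wall_mark_step R k m n.
(* Points are numbered from 0 and positive marks from 1. *)
have F' m : (0 < m <= k)%N -> ~ [/\ l < wall_mark R k m / 2, wall_mark R k m / 2 < l + h,
   b < wall_mark R k m / 2 & wall_mark R k m / 2 < b + h].
  by case: m => // m /= mk; exact: F.
rewrite /witness /contains.
case: (leqP i k) => ik /=; case: (leqP j k) => jk /=; try lia.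
- by move=> ci cj; have [|] := st i j => // *; apply: (F' j); [lia|crush].
- case: (leqP j (2 * k)) => jk2 /= ci cj.
    have [|_ jp] := st 0%N (j - k)%N; first by lia.
    by apply: (F' (j - k)%N); [lia|crush].
  by apply: (F' k); [lia|rewrite w1; crush].
- case: (leqP i (2 * k)) => ik2 /=; case: (leqP j (2 * k)) => jk2 /= ci cj; try lia.
    have [|ijs jp] := st (i - k)%N (j - k)%N; first by lia.
    by apply: (F' (j - k)%N); [lia|crush].
  by apply: (F' k); [lia|rewrite w1; crush].
Qed.

Lemma card_le_image_distinct (T : Type) (X : nat -> T) n : (forall i j, (i < j < n)%N -> X i <> X j) -> (`I_n #<= X @` `I_n)%card.
Proof.
move=> sep.
suff : (X @` `I_n #= `I_n)%card by rewrite card_eq_le => /andP[].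
apply: inj_card_eq => i j; rewrite !inE /= => ik jk E.
case: (ltngtP i j) => // ij.
  by case: (sep i j) => //; rewrite ij.
by case: (sep j i) => //; rewrite ij.
Qed.

Lemma self_coverability_lower_bound (R : realType) (C : set 'rV[R]_2) (k : nat) g :
  is_closed_square C -> (0 < k)%N ->
  self_coverability_function (homothets C) g -> (2 * k + 2 <= g k)%N.
Proof.
move=> hC k0 scg.
have hCC : homothets C C.
  exists 1, 0; split=> //; rewrite /homothet; apply/seteqP; split=> [x Cx|_ [x Cx <-]].
    by exists x => //; rewrite scale1r addr0.
  by rewrite scale1r addr0.
have [p [u [u0 EC HC]]] := homothets_frame hC hCC.
pose d m : R := wall_mark R k m.+1 / 2.
pose f m := frame_pt p u (d m) (d m).
have d_inj m n : (m < n)%N -> d m < d n.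
  rewrite /d -ltnS => /(wall_mark_step R k)[]; lra.
have w1 := wall_mark_top R k0.
have d01 m : (m < k)%N -> 0 <= d m <= 1.
  move=> mk; rewrite /d; have [_ ?] := @wall_mark_step R k 0 m.+1 isT.
  move: mk; rewrite leq_eqVlt => /orP[/eqP ->|/(wall_mark_step R k)[]]; rewrite ?w1; lra.
have Pk : (f @` `I_k #= `I_k)%card.
  apply: inj_card_eq => m n _ _ /(congr1 (abscissa p u)).
  have [-> _] := frame_ptK p (d m) (d m) u0; have [-> _] := frame_ptK p (d n) (d n) u0.
  by move=> E; case: (ltngtP m n) => // /d_inj; rewrite E ltxx.
have PC : f @` `I_k `<=` C.
  move=> _ [m /= mk <-]; rewrite EC /frame_square /contains /f /=.
  have [-> ->] := frame_ptK p (d m) (d m) u0.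
  by have := d01 _ mk; split; lra.
have [F' [F'h F'g F'C F'P]] := scg C (f @` `I_k) k hCC PC Pk.
pose w i := frame_pt p u (witness R k i).1 (witness R k i).2.
have wE i : abscissa p u (w i) = (witness R k i).1 /\ ordinate p u (w i) = (witness R k i).2.
  exact: frame_ptK.
(* Indices past [2 * k + 1] repeat [(1, 1)], so the choice of a covering member is total; separation
   makes it injective below [2 * k + 2]. *)
have wX i : exists X, F' X /\ X (w i).
  have : C (w i).
    rewrite EC /frame_square /contains /=; have [-> ->] := wE i.
    by have [? ?] := witness_in_unit R i k0; split; lra.
  by rewrite -F'C => -[X F'X Xw]; exists X.
have [X XP] := choice wX.
have sep i j : (i < j < 2 * k + 2)%N -> X i <> X j.
  move=> ij EX; have [F'i Xi] := XP i; have [_] := XP j; rewrite -EX => Xj.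
  have [l [b [h [h0 Eh]]]] := (HC _).1 (F'h _ F'i).
  have Q : [/\ 0 <= l, l + h <= 1, 0 <= b & b + h <= 1].
    apply: (@unit_frame_squareP _ p u _ _ _ u0 h0); rewrite -Eh -EC -F'C.
    by move=> x Xx; exists (X i).
  move: Xi Xj; rewrite Eh /frame_square /=.
  have [-> ->] := wE i; have [-> ->] := wE j; rewrite -!surjective_pairing.
  apply: (witness_separated k0 ij Q) => m mk /= N.
  apply: (F'P _ (f m) F'i); first by exists m.
  by rewrite Eh; apply/frame_square_interior => //; rewrite /f; have [-> ->] := frame_ptK p (d m) (d m) u0.
rewrite -card_le_II; apply: (card_le_trans _ F'g).
apply: (@card_le_trans _ _ _ (X @` `I_(2 * k + 2))); last first.
  by apply: subset_card_le => _ [i _ <-]; exact: (XP i).1.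
exact: card_le_image_distinct.
Qed.

Theorem theorem7 (R : realType) (C : set 'rV[R]_2) (hC : is_closed_square C) :
  [/\ self_coverable (homothets C),
      self_coverability_function (homothets C) (fun k : nat => (2 * k + 2)%N) &
      forall (k : nat) (g : nat -> nat),
        (1 <= k)%N -> self_coverability_function (homothets C) g ->
        (2 * k + 2 <= g k)%N].
Proof.
split.
- split; first by move=> S; exact: homothets_closed.
  by exists (fun k : nat => (2 * k + 2)%N); exact: self_coverability_square.
- exact: self_coverability_square.
- by move=> k g; exact: self_coverability_lower_bound.
Qed.
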